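(* For every integer $n>3$, the triangle Artin group $A_{2,3,2n}$ is residually finite.
   Context: For integers $M,N,P\ge 2$ the triangle Artin group is $A_{M,N,P}=\langle a,b,c \mid (a,b)_M=(b,a)_M,\ (b,c)_N=(c,b)_N,\ (c,a)_P=(a,c)_P\rangle$, where $(s,t)_k$ denotes the alternating word $stst\cdots$ of length $k$ in the letters $s,t$ beginning with $s$. Thus $A_{2,3,2n}=\langle a,b,c\mid ab=ba,\ bcb=cbc,\ (ca)^n=(ac)^n\rangle$. A group $G$ is residually finite if for every nontrivial $g\in G$ there is a finite index subgroup $H\le G$ with $g\notin H$. *)

(* Defs.v *)
From HB Require Import structures.
From mathcomp Require Import all_boot generic_quotient.
From mathcomp Require Import boolp classical_sets cardinality.

Set Implicit Arguments.
Unset Strict Implicit.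
Unset Printing Implicit Defensive.

Local Open Scope quotient_scope.
Local Open Scope classical_set_scope.
Local Open Scope group_scope.

(* Group presentations <X | R>, with R a finite list of relations u = v.     *)
(* A letter (x, false) stands for the generator x, and (x, true) for x^-1.   *)

Definition word (X : Type) : Type := seq (X * bool).

Definition inv_letter (X : Type) (l : X * bool) : X * bool := (l.1, ~~ l.2).

Definition inv_word (X : Type) (w : word X) : word X :=
  rev (map (@inv_letter X) w).

Inductive pres_cong (X : choiceType) (R : seq (word X * word X)) :
    word X -> word X -> Prop :=
| pres_cong_refl u : pres_cong R u u
| pres_cong_sym u v : pres_cong R u v -> pres_cong R v u
| pres_cong_trans v u w :
    pres_cong R u v -> pres_cong R v w -> pres_cong R u w
| pres_cong_ctx p s u v :
    pres_cong R u v -> pres_cong R (p ++ u ++ s) (p ++ v ++ s)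
| pres_cong_cancel l : pres_cong R [:: l; inv_letter l] [::]
| pres_cong_rel u v : (u, v) \in R -> pres_cong R u v.

Section Presentation.
Variables (X : choiceType) (R : seq (word X * word X)).

Definition pres_rel : rel (seq (X * bool)) := fun u v => `[< pres_cong R u v >].

Lemma pres_rel_refl : reflexive pres_rel.
Proof. by move=> u; apply/asboolP/pres_cong_refl. Qed.

Lemma pres_rel_sym : symmetric pres_rel.
Proof. by move=> u v; apply/asboolP/asboolP; apply: pres_cong_sym. Qed.

Lemma pres_rel_trans : transitive pres_rel.
Proof.
by move=> v u w /asboolP uv /asboolP vw; apply/asboolP/(pres_cong_trans uv).
Qed.

Canonical pres_equiv := EquivRel pres_rel pres_rel_refl pres_rel_sym
  pres_rel_trans.

Definition presented : Type := {eq_quot pres_equiv}.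

HB.instance Definition _ := Choice.on presented.
HB.instance Definition _ := EqQuotient.on presented.

Definition class_of (u : word X) : presented := \pi_presented u.

Lemma class_ofP u v : class_of u = class_of v <-> pres_cong R u v.
Proof.
by split=> [/eqmodP/asboolP //|uv]; apply/eqmodP/asboolP.
Qed.

Lemma class_of_repr (g : presented) : class_of (repr g) = g.
Proof. exact: reprK. Qed.

Lemma pres_cong_cat u u' v v' :
  pres_cong R u u' -> pres_cong R v v' -> pres_cong R (u ++ v) (u' ++ v').
Proof.
move=> uu' vv'; apply: (@pres_cong_trans _ _ (u' ++ v)).
  by have := pres_cong_ctx [::] v uu'.
by have := pres_cong_ctx u' [::] vv'; rewrite !cats0.
Qed.

Lemma inv_letterK : involutive (@inv_letter X).
Proof. by case=> x b; rewrite /inv_letter /= negbK. Qed.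

Lemma inv_wordK : involutive (@inv_word X).
Proof.
by move=> u; rewrite /inv_word map_rev revK -map_comp map_id_in // => l _ /=;
  rewrite inv_letterK.
Qed.

Lemma pres_cong_mulV u : pres_cong R (u ++ inv_word u) [::].
Proof.
elim: u => [|l u IHu]; first exact: pres_cong_refl.
rewrite /inv_word /= rev_cons -cats1 -/(inv_word u).
apply: (@pres_cong_trans _ _ [:: l; inv_letter l]); last exact: pres_cong_cancel.
by have := pres_cong_ctx [:: l] [:: inv_letter l] IHu; rewrite /= catA.
Qed.

Lemma pres_cong_mulVw u : pres_cong R (inv_word u ++ u) [::].
Proof. by have := pres_cong_mulV (inv_word u); rewrite inv_wordK. Qed.

Lemma pres_cong_inv u v :
  pres_cong R u v -> pres_cong R (inv_word u) (inv_word v).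
Proof.
move=> uv; apply: (@pres_cong_trans _ _ (inv_word u ++ v ++ inv_word v)).
  rewrite -[X in pres_cong _ X _]cats0; apply: pres_cong_cat.
    exact: pres_cong_refl.
  exact/pres_cong_sym/pres_cong_mulV.
rewrite catA -[X in pres_cong _ _ X]cat0s.
apply: pres_cong_cat; last exact: pres_cong_refl.
apply: pres_cong_trans (pres_cong_mulVw u).
by apply: pres_cong_cat; [exact: pres_cong_refl | exact: pres_cong_sym].
Qed.

Definition pres_one : presented := class_of [::].
Definition pres_mul (g h : presented) : presented :=
  class_of (repr g ++ repr h).
Definition pres_inv (g : presented) : presented :=
  class_of (inv_word (repr g)).

Lemma pres_cong_repr u : pres_cong R (repr (class_of u)) u.
Proof. by apply/class_ofP; rewrite class_of_repr. Qed.

Lemma pres_mulE u v : pres_mul (class_of u) (class_of v) = class_of (u ++ v).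
Proof. by apply/class_ofP; apply: pres_cong_cat; apply: pres_cong_repr. Qed.

Lemma pres_invE u : pres_inv (class_of u) = class_of (inv_word u).
Proof. by apply/class_ofP/pres_cong_inv/pres_cong_repr. Qed.

Lemma pres_mulA : associative pres_mul.
Proof.
move=> x y z; rewrite -[x]class_of_repr -[y]class_of_repr -[z]class_of_repr.
by rewrite !pres_mulE catA.
Qed.

Lemma pres_mul1 : left_id pres_one pres_mul.
Proof. by move=> x; rewrite -[x]class_of_repr pres_mulE. Qed.

Lemma pres_mulr1 : right_id pres_one pres_mul.
Proof. by move=> x; rewrite -[x]class_of_repr pres_mulE cats0. Qed.

Lemma pres_mulVl : left_inverse pres_one pres_inv pres_mul.
Proof.
move=> x; rewrite -[x]class_of_repr pres_invE pres_mulE.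
exact/class_ofP/pres_cong_mulVw.
Qed.

Lemma pres_mulVr : right_inverse pres_one pres_inv pres_mul.
Proof.
move=> x; rewrite -[x]class_of_repr pres_invE pres_mulE.
exact/class_ofP/pres_cong_mulV.
Qed.

HB.instance Definition _ := isGroup.Build presented
  pres_mulA pres_mul1 pres_mulr1 pres_mulVl pres_mulVr.

End Presentation.

Section UniversalProperty.
Variables (X : choiceType) (R : seq (word X * word X)).

Definition gen (x : X) : presented R := class_of R [:: (x, false)].

Definition eval_word (G : groupType) (f : X -> G) (w : word X) : G :=
  \prod_(l <- w) (if l.2 then (f l.1)^-1 else f l.1).

Lemma class_ofM u v : class_of R (u ++ v) = class_of R u * class_of R v.
Proof. by rewrite -pres_mulE. Qed.

Lemma class_ofV u : class_of R (inv_word u) = (class_of R u)^-1.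
Proof. by rewrite -pres_invE. Qed.

Lemma class_of_eval w : class_of R w = eval_word gen w.
Proof.
rewrite /eval_word; elim: w => [|[x b] w IHw]; first by rewrite big_nil.
rewrite big_cons -IHw -cat1s class_ofM; case: b => //=.
by rewrite -class_ofV.
Qed.

Lemma eval_cong (G : groupType) (f : X -> G) :
    (forall u v, (u, v) \in R -> eval_word f u = eval_word f v) ->
  forall u v, pres_cong R u v -> eval_word f u = eval_word f v.
Proof.
move=> fR u v; elim=> [//|u1 v1 _ -> //|v1 u1 w1 _ -> _ -> //| | |].
- by move=> p s u1 v1 _; rewrite /eval_word !big_cat /= => ->.
- move=> [x b]; rewrite /eval_word big_cons big_seq1 big_nil.
  by case: b => /=; rewrite ?mulgV ?mulVg.
- by move=> u1 v1 /fR.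
Qed.

Lemma presented_universal (G : groupType) (f : X -> G) :
    (forall u v, (u, v) \in R -> eval_word f u = eval_word f v) ->
  exists! h : presented R -> G,
    {morph h : x y / x * y} /\ forall x, h (gen x) = f x.
Proof.
move=> fR; pose h (g : presented R) := eval_word f (repr g).
have hE w : h (class_of R w) = eval_word f w.
  exact/(eval_cong fR)/pres_cong_repr.
exists h; split; first split.
- move=> x y; rewrite -[x]class_of_repr -[y]class_of_repr -class_ofM !hE.
  by rewrite /eval_word big_cat.
- by move=> x; rewrite hE /eval_word big_seq1.
move=> k [kM kgen]; apply/funext => x; rewrite -[x]class_of_repr hE.
have k1 : k 1 = 1 by apply: (mulgI (k 1)); rewrite -kM !mulg1.
have kV y : k y^-1 = (k y)^-1.
  by apply: (mulgI (k y)); rewrite -kM !mulgV.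
rewrite class_of_eval /eval_word; elim: (repr x) => [|[y b] w IHw].
  by rewrite !big_nil k1.
by rewrite !big_cons kM IHw; case: b => /=; rewrite ?kV kgen.
Qed.

End UniversalProperty.

Inductive artin_gen := ga | gb | gc.

Definition artin_gen_code (x : artin_gen) : option bool :=
  match x with ga => None | gb => Some false | gc => Some true end.

Definition artin_gen_decode (o : option bool) : artin_gen :=
  match o with None => ga | Some false => gb | Some true => gc end.

Lemma artin_gen_codeK : cancel artin_gen_code artin_gen_decode.
Proof. by case. Qed.

HB.instance Definition _ := Choice.copy artin_gen (can_type artin_gen_codeK).

(* The positive word s t s t ... of length k.                                *)
Definition alt_word (X : Type) (s t : X) (k : nat) : word X :=
  mkseq (fun i => (if odd i then t else s, false)) k.

Definition triangle_artin (M N P : nat) : groupType :=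
  presented [:: (alt_word ga gb M, alt_word gb ga M);
                (alt_word gb gc N, alt_word gc gb N);
                (alt_word gc ga P, alt_word ga gc P)].

Definition finite_index (G : groupType) (H : set G) : Prop :=
  finite_set (range (fun g : G => [set g * h | h in H])).

Definition residually_finite (G : groupType) : Prop :=
  forall g : G, g <> 1 ->
    exists H : set G, [/\ group_closed [in H], finite_index H & ~ H g].

(* Main.v *)
Require Import Defs.
From mathcomp Require Import all_boot.
From HB Require Import structures.
From mathcomp Require Import fingroup perm zify.
From mathcomp Require Import boolp classical_sets cardinality.

(* Put y = cb, s = bcb, so that b = s y^-1, c = y^-1 s and s^2 = y^3 =: z. The
   group is an amalgam A *_C U, where C has index 2 in A = <C, s>, and U = <V, y>
   with V normal of index 3 in U. The group V is generated by z and three lines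
   (A_k), (B_k), (C_k), where a line is a sequence whose products of n
   consecutive terms are all equal; up to shifts and conjugation by z, y
   permutes the three lines cyclically. The subgroup C is generated by z and the
   first two lines, which s exchanges, again up to z. Both V and C are free, and
   C is a free factor of V; this is where n > 3 is needed, as the third line
   then has four consecutive terms in C and n - 4 free ones. Since C is a
   retract of V, every representation of C on a finite set extends to V. Hence
   the intersections W(V) and W(C) of the kernels of all representations on m
   points satisfy W(V) :&: C = W(C), which is stable under s: for each m we get
   a finite quotient U/W(V) in which conjugation by s still makes sense on the
   image of C. An element u_0 s u_1 ... s u_L with u_1, ..., u_(L-1) outside C
   is then detected by gluing L + 1 copies of U/W(V) along cosets of that image,
   in such a way that s leads from each copy to the next. *)

Set Implicit Arguments.
Unset Strict Implicit.
Unset Printing Implicit Defensive.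

Local Open Scope group_scope.

(** * Homomorphisms *)

Local Notation hom := UMagmaMorphism.type.

Section Homs.
Variables (G H : groupType) (f : G -> H).

Definition mk_hom (fM : {morph f : x y / x * y}) : hom G H :=
  let f1 : f 1 = 1 :=
    mulgI (f 1) _ _
      (etrans (esym (fM 1 1)) (etrans (congr1 f (mulg1 1)) (esym (mulg1 (f 1))))) in
  HB.pack f (isMultiplicative.Build G H f fM)
    (Multiplicative_isUMagmaMorphism.Build G H f f1).

Lemma mk_homE (fM : {morph f : x y / x * y}) x : mk_hom fM x = f x.
Proof. by []. Qed.

End Homs.

(** [H] is the stabilizer of [t]; as products act from left to right, the left coset of [x] is
    determined by the point [eta x^-1 t]. *)
Lemma residual_stabilizer (G : groupType) (T : finType) (eta : hom G {perm T})
    (g : G) (t : T) :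
  eta g t != t ->
  exists H : set G, [/\ group_closed [in H], finite_index H & ~ H g].
Proof.
move=> gt; pose H : set G := [set x | eta x t = t]%classic.
exists H; split; last exact/eqP.
- split=> [|x y]; rewrite !inE /H /= ?gmulf1 ?perm1 // => xt yt.
  by rewrite gmulfM gmulfV permM xt -{1}yt permK.
- pose F (u : T) : set G := [set x | eta x u = t]%classic.
  apply: (@sub_finite_set _ _ (F @` setT)%classic); last first.
    by apply: finite_image; apply: finite_finset.
  move=> _ [x _ <-]; exists (eta x^-1 t) => //.
  apply/seteqP; split=> w; rewrite /F /H /=.
    by move=> wt; exists (x^-1 * w); rewrite ?mulVKg //= gmulfM permM.
  by move=> [h ht <-]; rewrite -permM -gmulfM mulKg.
Qed.

Lemma pres_hom (X : choiceType) (R : seq (word X * word X)) (G : groupType)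
    (f : X -> G) :
  (forall u v, (u, v) \in R -> eval_word f u = eval_word f v) ->
  exists h : hom (presented R) G, forall x, h (gen R x) = f x.
Proof. by move=> /presented_universal [h [[hM hg] _]]; exists (mk_hom hM). Qed.

Lemma pres_hom_eval (X : choiceType) (R : seq (word X * word X)) (G : groupType)
    (h : hom (presented R) G) w :
  h (class_of R w) = eval_word (fun x => h (gen R x)) w.
Proof.
rewrite class_of_eval /eval_word gmulf_prod; apply: eq_bigr => [[x []]] _ //=.
exact: gmulfV.
Qed.

Lemma pres_hom_ext (X : choiceType) (R : seq (word X * word X)) (G : groupType)
    (f g : hom (presented R) G) :
  (forall x, f (gen R x) = g (gen R x)) -> f =1 g.
Proof.
move=> fg x; rewrite -[x]class_of_repr !pres_hom_eval.
by apply: eq_bigr => l _; rewrite fg.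
Qed.

Lemma gen_rel (X : choiceType) (R : seq (word X * word X)) u v :
  (u, v) \in R -> eval_word (gen R) u = eval_word (gen R) v.
Proof. by move=> uv; rewrite -!class_of_eval; apply/class_ofP/pres_cong_rel. Qed.

(** * Residual finiteness of free groups *)

(** Composing with the transposition of [p x] and [y] disturbs none of the values already
    prescribed. *)
Lemma perm_extend (T : finType) (ps : seq (T * T)) :
  uniq (unzip1 ps) -> uniq (unzip2 ps) ->
  exists p : {perm T}, forall q, q \in ps -> p q.1 = q.2.
Proof.
elim: ps => [|[x y] ps IHps] /=; first by exists 1.
move=> /andP[xps ups1] /andP[yps ups2]; have [p pE] := IHps ups1 ups2.
exists (p * tperm (p x) y) => q; rewrite inE => /predU1P[-> | qps] /=.
  by rewrite permM tpermL.
rewrite permM pE // tpermD //.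
  by rewrite -(pE _ qps) (inj_eq perm_inj); apply: contraNneq xps => ->; apply: map_f.
by apply: contraNneq yps => ->; apply: map_f.
Qed.

(** A shortest word works, since a cancelling pair could be deleted. *)
Lemma reduced_word (X : choiceType) (R : seq (word X * word X)) (v : presented R) :
  exists2 w, class_of R w = v &
    forall i l, i.+1 < size w -> nth l w i.+1 != inv_letter (nth l w i).
Proof.
have ex : exists k, `[< exists2 w, class_of R w = v & size w = k >].
  exists (size (generic_quotient.repr v)); apply/asboolP.
  by exists (generic_quotient.repr v); rewrite ?class_of_repr.
have [_ /asboolP[w wv <-] wmin] := ex_minnP ex.
exists w => // i l iw; apply/negP => /eqP wi.
suff /asboolP/wmin : exists2 w', class_of R w' = v & size w' = (size w).-2 by lia.
exists (take i w ++ drop i.+2 w); last by rewrite size_cat size_take size_drop; case: ifP; lia.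
rewrite -wv -[in RHS](cat_take_drop i w) (drop_nth l (ltnW iw)) (drop_nth l iw) wi.
apply/class_ofP/pres_cong_sym.
exact: (pres_cong_ctx (take i w) (drop i.+2 w) (pres_cong_cancel R (nth l w i))).
Qed.

(** A reduced word w labels the edges of a path 0, ..., |w|, so each generator is a partial
    injection; once these are extended to permutations, w carries 0 to |w|. Every large [m] is
    allowed so that finitely many elements can share one. *)
Lemma free_group_rf (X : choiceType) (v : presented (X := X) [::]) : v <> 1 ->
  exists m0, forall m, m0 <= m ->
    exists f : hom (presented (X := X) [::]) {perm 'I_m}, f v <> 1.
Proof.
move=> v1; have [w wv wred] := reduced_word v.
exists (size w).+1 => -[//|m] /ltnSE wm.
case: w => [|l w'] in wv wred wm *; first by case: v1; rewrite -wv.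
set w := l :: w' in wv wred wm *.
pose src i := inord (i + (nth l w i).2) : 'I_m.+1.
pose tgt i := inord (i + ~~ (nth l w i).2) : 'I_m.+1.
have vsrc i : i < size w -> src i = (i + (nth l w i).2)%N :> nat.
  by move=> iw; rewrite inordK //; case: ((nth l w i).2); lia.
have vtgt i : i < size w -> tgt i = (i + ~~ (nth l w i).2)%N :> nat.
  by move=> iw; rewrite inordK //; case: ((nth l w i).2); lia.
have adj i x b b' : i.+1 < size w -> nth l w i = (x, b) -> nth l w i.+1 = (x, b') ->
    b = b'.
  move=> iw wi wi1; have := wred i l iw; rewrite wi wi1 /inv_letter /=.
  by case: b {wi}; case: b' {wi1}; rewrite ?eqxx.
have [p pE] : exists p : X -> {perm 'I_m.+1},
    forall i, i < size w -> p (nth l w i).1 (src i) = tgt i.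
  suff /choice[p pE] : forall x, exists p : {perm 'I_m.+1}, forall i, i < size w ->
      (nth l w i).1 = x -> p (src i) = tgt i.
    by exists p => i iw; apply: pE.
  move=> x; pose s := [seq i <- iota 0 (size w) | (nth l w i).1 == x].
  have sP i : i \in s -> i < size w /\ nth l w i = (x, (nth l w i).2).
    rewrite mem_filter mem_iota => /andP[/eqP <- /=]; rewrite add0n => ->.
    by split=> //; case: nth.
  have us : uniq s by rewrite filter_uniq ?iota_uniq.
  have [||p pE] := @perm_extend _ [seq (src i, tgt i) | i <- s].
  - rewrite /unzip1 -map_comp map_inj_in_uniq // => i k /sP[iw wi] /sP[kw wk] /=.
    move/(congr1 val) => /=; rewrite vsrc // vtgt // || rewrite !vsrc //.
    case bi: (nth l w i).2 wi; case bk: (nth l w k).2 wk => wk wi ik; first by lia.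
    + have ki : k = i.+1 by lia.
      by have := @adj i x true false; rewrite -ki => /(_ kw wi wk).
    + have ki : i = k.+1 by lia.
      by have := @adj k x true false; rewrite -ki => /(_ iw wk wi).
    + by lia.
  - rewrite /unzip2 -map_comp map_inj_in_uniq // => i k /sP[iw wi] /sP[kw wk] /=.
    move/(congr1 val) => /=; rewrite !vtgt //.
    case bi: (nth l w i).2 wi; case bk: (nth l w k).2 wk => wk wi ik; first by lia.
    + have ki : i = k.+1 by lia.
      by have := @adj k x false true; rewrite -ki => /(_ iw wk wi).
    + have ki : k = i.+1 by lia.
      by have := @adj i x false true; rewrite -ki => /(_ kw wi wk).
    + by lia.
  exists p => i iw wi; apply: (pE (src i, tgt i)); apply/mapP; exists i => //.
  by rewrite mem_filter mem_iota wi eqxx.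
have [|f fE] := @pres_hom X [::] _ p; first by [].
exists f; rewrite -wv pres_hom_eval /eval_word => /permP/(_ ord0); rewrite perm1.
suff walk k : k <= size w ->
    (\prod_(a <- take k w) (if a.2 then (f (gen [::] a.1))^-1 else f (gen [::] a.1)))
      ord0 = inord k :> 'I_m.+1.
  have := walk _ (leqnn _); rewrite take_size => -> /(congr1 val) /=.
  by rewrite inordK.
elim: k => [|k IHk] kw; first by rewrite take0 big_nil perm1; apply: val_inj; rewrite /= inordK.
rewrite (take_nth l) // -cats1 big_cat big_seq1 permM IHk 1?ltnW //= !fE.
have := pE _ kw; rewrite /src /tgt; case: (nth l w k) => x [] /=; rewrite ?addn0 ?addn1 //.
by move=> <-; rewrite permK.
Qed.

(** * Amalgams over retracts *)

Lemma comp_hom_subproof (G H K : groupType) (f : hom H K) (g : hom G H) :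
  {morph (fun x => f (g x)) : x y / x * y}.
Proof. by move=> x y; rewrite !gmulfM. Qed.

Definition comp_hom (G H K : groupType) (f : hom H K) (g : hom G H) : hom G K :=
  mk_hom (@comp_hom_subproof G H K f g).

Section Amalgam.
Variables (V C G : groupType) (X : finType) (x : X -> V).
Hypothesis x_gen : forall (P : groupType) (f g : hom V P),
  (forall i, f (x i) = g (x i)) -> f =1 g.
Hypothesis V_rf : forall v : V, v <> 1 -> exists m0, forall m, m0 <= m ->
  exists f : hom V {perm 'I_m}, f v <> 1.
Variables (iota : hom C V) (rho : hom V C) (psi : hom V V) (tau : hom C C) (z : C).
Hypothesis rhoK : cancel iota rho.
Hypothesis psi3 : forall v, psi (psi (psi v)) * iota z = iota z * v.
Hypothesis psiz : psi (iota z) = iota z.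
Hypothesis tau2 : forall c, z * tau (tau c) = c * z.
Hypothesis tauz : tau z = z.

(** * Finite quotients compatible with [psi] and [tau] *)

Section FiniteQuotient.
Variable m : nat.

Notation D := {ffun X -> {perm 'I_m}}.

(** A tuple in [D] prescribes the images of the [x i]; tuples coming from no representation receive
    the trivial one. *)
Lemma all_homs_subproof : exists h : D -> hom V {perm 'I_m},
  forall f : hom V {perm 'I_m}, exists d, f =1 h d.
Proof.
have triv : {morph (fun _ : V => 1 : {perm 'I_m}) : u v / u * v}.
  by move=> u v; rewrite mulg1.
have /choice[h hE] : forall d : D, exists f : hom V {perm 'I_m},
    (exists f' : hom V {perm 'I_m}, forall i, f' (x i) = d i) -> forall i, f (x i) = d i.
  move=> d; case: (pselect (exists f' : hom V {perm 'I_m}, forall i, f' (x i) = d i)).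
    by move=> [f fd]; exists f.
  by move=> nf; exists (mk_hom triv).
exists h => f; exists [ffun i => f (x i)]; apply: x_gen => i.
by rewrite hE ?ffunE //; exists f => k; rewrite ffunE.
Qed.

(* The representations of V on 'I_m, each induced up to the extension of V by
   a cube root of [iota z] acting as [psi]. *)
Lemma finite_quotient : exists (K : finGroupType) (h : hom V K) (y : K),
  [/\ forall v, y * h v = h (psi v) * y,
      y * y * y = h (iota z),
      forall c, h (iota c) = 1 -> h (iota (tau c)) = 1,
      forall (i : 'I_3) v c, 0 < m -> 0 < i -> h v * y ^+ i <> h (iota c)
    & (forall v, h v = 1 -> forall f : hom V {perm 'I_m}, f v = 1) /\
      (forall v c, h v = h (iota c) ->
         forall f : hom V {perm 'I_m}, f v = f (iota (rho v)))].
Proof.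
have [H HP] := all_homs_subproof.
pose T := (D * 'I_m * 'I_3)%type.
pose a v (t : T) : T := (t.1.1, H t.1.1 (iter t.2 psi v) t.1.2, t.2).
have a_inj v : injective (a v).
  move=> [[d p] i] [[d' p'] i'] /= /[dup] /(congr1 snd) /= ii'.
  by rewrite /a /= -ii' => /(congr1 fst) -[<-] /perm_inj ->.
pose h v := perm (a_inj v).
have hE v d p i : h v (d, p, i) = (d, H d (iter i psi v) p, i) by rewrite permE.
have iterM i : {morph iter i psi : u v / u * v}.
  by elim: i => // i IHi u v; rewrite !iterS IHi gmulfM.
have hM : {morph h : u v / u * v}.
  move=> u v; apply/permP => -[[d p] i]; rewrite permM !hE; congr (_, _, _).
  by rewrite iterM gmulfM permM.
(* [iota z] is applied only when the last coordinate wraps around, which makes [b] a cube root of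
   its action. *)
pose b (t : T) : T :=
  if t.2 == ord_max then (t.1.1, H t.1.1 (iota z) t.1.2, ord0) else (t.1, inord t.2.+1).
have iter_z i : iter i psi (iota z) = iota z by elim: i => // i IHi; rewrite iterS IHi.
have bS d p k : k < 2 -> b (d, p, inord k) = (d, p, inord k.+1).
  by move=> k2; rewrite /b /= -val_eqE /= inordK; case: k k2 => [|[]].
have b2 d p : b (d, p, inord 2) = (d, H d (iota z) p, inord 0).
  by rewrite /b /= -val_eqE /= inordK //=; congr (_, _); apply: val_inj; rewrite /= inordK.
have b3 t : b (b (b t)) = h (iota z) t.
  case: t => [[d p] i]; rewrite -(inord_val i) hE iter_z.
  have := ltn_ord i; case: (nat_of_ord i) => [|[|[|//]]] _.
  - by rewrite 2?bS // b2.
  - by rewrite bS // b2 bS.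
  - by rewrite b2 2?bS.
have b_inj : injective b.
  by move=> t t' tt'; apply: (@perm_inj _ (h (iota z))); rewrite -!b3 tt'.
pose y := perm b_inj.
have yh v : y * h v = h (psi v) * y.
  apply/permP => -[[d p] i]; rewrite !permM [y (d,_,_)]permE hE [y (_,_,_)]permE /b /=.
  case: eqP => [-> /= | /eqP i2]; rewrite hE //=.
    by congr (_, _, _); rewrite -!permM -!gmulfM psi3.
  have i3 : i.+1 < 3 by case: i i2 => [[|[|[|//]]] ?].
  by rewrite inordK //=; congr (_, H d _ _, _); rewrite -iterSr.
have lab (i : 'I_3) d p : (y ^+ i) (d, p, ord0) = (d, p, i).
  have step k : k <= i -> (y ^+ k) (d, p, ord0) = (d, p, inord k).
    elim: k => [|k IHk] ki.
      by rewrite expg0 perm1; congr (_, _); apply: val_inj; rewrite /= inordK.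
    by rewrite expgSr permM IHk 1?ltnW // permE bS // (leq_trans ki) // -ltnS.
  by rewrite step // inord_val.
have h1 v : (forall f : hom V {perm 'I_m}, f v = 1) -> h v = 1.
  move=> fv; apply/permP => -[[d p] i]; rewrite hE perm1; congr (_, _, _).
  suff -> : H d (iter i psi v) = 1 by rewrite perm1.
  elim: {p}(i : nat) v fv => // k IHk v fv; rewrite iterSr; apply: IHk => f.
  exact: (fv (comp_hom f psi)).
have hh v v' : h v = h v' -> forall f : hom V {perm 'I_m}, f v = f v'.
  move=> /permP vv' f; have [d fd] := HP f; apply/permP => p.
  by have := vv' (d, p, ord0); rewrite !hE => -[]; rewrite -!fd.
have h_1 : h 1 = 1 by exact: (@gmulf1 _ _ (mk_hom hM)).
exists {perm T}, (mk_hom hM), y; split=> //.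
- by apply/permP => t; rewrite !permM ![y _]permE b3.
(* The retraction turns [f] on C, twisted by [tau], into a representation of V on the same m points;
   it kills [iota c]. *)
- move=> c /= hc; apply: h1 => f.
  have := hh (iota c) 1; rewrite hc h_1 => /(_ erefl).
  by move/(_ (comp_hom (comp_hom f iota) (comp_hom tau rho))); rewrite gmulf1 /= rhoK.
(* The power of [y] moves the last coordinate, which the image of V preserves. *)
- move=> i v c m0 i0 /= /permP/(_ (1, Ordinal m0, ord0)); rewrite permM !hE /=.
  by rewrite lab => -[] /= _ i00; rewrite i00 in i0.
split=> [v hv f | v c vc f].
  by rewrite (hh v 1) ?gmulf1 // h_1.
by rewrite [LHS](hh _ _ vc) -{1}[c]rhoK -[LHS](hh _ _ vc (comp_hom (comp_hom f iota) rho)).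
Qed.

End FiniteQuotient.

(** * Gluing copies of a finite quotient *)

Section Torsors.
Variables (K : finGroupType) (h : hom V K).
Hypothesis h_tau : forall c, h (iota c) = 1 -> h (iota (tau c)) = 1.
Variables (L : nat) (e : nat -> K).
Hypothesis eC : forall j c, 0 < j < L -> e j <> h (iota c).

Notation T := (bool * 'I_L.+1 * K)%type.
Notation g := (comp_hom h iota).

Lemma transl_inj (k : K) : injective (fun t : T => (t.1, t.2 * k)).
Proof. by move=> [p a] [q b] /= [-> /mulIg ->]. Qed.

Lemma transl_morph : {morph (fun k => perm (@transl_inj k)) : k l / k * l}.
Proof. by move=> k l; apply/permP => -[p a]; rewrite permM !permE /= mulgA. Qed.

Definition transl : hom K {perm T} := mk_hom transl_morph.

Lemma translE k b j a : transl k (b, j, a) = (b, j, a * k).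
Proof. by rewrite /transl mk_homE permE. Qed.

(* T consists of two coloured families of L + 1 copies of K, on which V acts by
   right translation. Each copy is a union of cosets of h(iota C); [S] changes
   the colour, sends the coset of [e j] in the j-th copy to the coset of 1 in
   the next one and back, and fixes all other cosets, acting as [tau] relative
   to base points. The factors [zt] are distributed so that [S * S] is the
   translation by z. *)
Lemma torsor_perm : exists S : {perm T},
  [/\ S * S = transl (g z),
      forall c, S * transl (g (tau c)) = transl (g c) * S
    & forall b j, j < L -> S (b, inord j, e j) = (~~ b, inord j.+1, 1)].
Proof.
pose Cb := [set a : K | `[< exists c, a = g c >]].
have CbP a : reflect (exists c, a = g c) (a \in Cb) by rewrite inE; apply: asboolP.
have gCb c : g c \in Cb by apply/CbP; exists c.
have Cg : group_set Cb.
  apply/group_setP; split=> [|_ _ /CbP[c ->] /CbP[d ->]]; apply/CbP.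
    by exists 1; rewrite gmulf1.
  by exists (c * d); rewrite gmulfM.
pose Cgp : {group K} := Group Cg.
have CgP a : a \in Cgp -> exists c, a = g c by move/CbP.
(* [h_tau] makes [tau] well defined on the image of C; 1 is a default value elsewhere. *)
have [tb tbE] : exists tb : K -> K, forall c, tb (g c) = g (tau c).
  have /choice[tb tbP] : forall a, exists a', forall c, a = g c -> a' = g (tau c).
    move=> a; case: (pselect (exists c, a = g c)) => [[c ->]|na]; last first.
      by exists 1 => c ac; case: na; exists c.
    exists (g (tau c)) => d cd; apply/divg1_eq; rewrite -!gmulfF.
    by apply: h_tau; have : g (c / d) = 1 by rewrite gmulfF cd mulgV.
  by exists tb => c; apply: (tbP (g c)).
(* [exit] and [entr] mark the cosets joined to the next and the previous copy; [nj] and [na] give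
   the copy and the base point of the image coset. *)
pose exit (j : nat) a := (j < L) && (a \in e j *: Cgp).
pose entr (j : nat) a := (0 < j) && (a \in Cgp).
pose base j a := if exit j a then e j else repr (a *: Cgp).
pose nj j a : nat := if exit j a then j.+1 else if entr j a then j.-1 else j.
pose na j a := if exit j a then 1 else if entr j a then e j.-1 else base j a.
(* A crossing and its reverse carry the factors 1 and z; on a coset that keeps its place, the colour
   decides which comes first. *)
pose zt b j a := if exit j a then 1 else if entr j a || b then g z else 1.
have coset_eq a c : (a * g c) *: Cgp = a *: Cgp.
  by apply/lcoset_eqP; rewrite mem_lcoset mulKg.
have exitM j a c : exit j (a * g c) = exit j a.
  by rewrite /exit !mem_lcoset mulgA (groupMr _ (gCb c : g c \in Cgp)).
have entrM j a c : entr j (a * g c) = entr j a.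
  by rewrite /entr (groupMr _ (gCb c : g c \in Cgp)).
have baseM j a c : base j (a * g c) = base j a by rewrite /base exitM coset_eq.
have njM j a c : nj j (a * g c) = nj j a by rewrite /nj exitM entrM.
have naM j a c : na j (a * g c) = na j a by rewrite /na exitM entrM baseM.
have ztM b j a c : zt b j (a * g c) = zt b j a by rewrite /zt exitM entrM.
have base_in j a : exists c, a = base j a * g c.
  suff /CbP[c ac] : (base j a)^-1 * a \in Cb by exists c; rewrite -ac mulVKg.
  rewrite /base; case: ifP => [/andP[_]|_]; first by rewrite mem_lcoset.
  rewrite -(mem_lcoset Cgp).
  have : repr (a *: Cgp) \in a *: Cgp by apply: mem_repr (lcoset_refl _ _).
  by move/lcoset_eqP => ->; apply: lcoset_refl.
(* By [eC], the coset through which an inner copy is entered is not the one through which it is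
   left. *)
have exit1 j : j <= L -> 0 < j -> exit j 1 = false.
  move=> jL j0; apply/negP => /andP[jL']; rewrite mem_lcoset mulg1 => /groupVl/CgP[c].
  by apply: eC; rewrite j0.
have entr1 j : 0 < j -> entr j 1 by move=> j0; rewrite /entr j0 group1.
have exite j : j < L -> exit j (e j) by move=> jL; rewrite /exit jL lcoset_refl.
have base1 j : j <= L -> 0 < j -> base j 1 = 1.
  by move=> jL j0; rewrite /base exit1 // lcoset1 repr_group.
pose f (t : T) : T := (~~ t.1.1, inord (nj t.1.2 t.2),
  na t.1.2 t.2 * zt t.1.1 t.1.2 t.2 * tb ((base t.1.2 t.2)^-1 * t.2)).
have fE b (j : 'I_L.+1) a c : a = base j a ->
    f (b, j, a * g c) = (~~ b, inord (nj j a), na j a * zt b j a * g (tau c)).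
  by move=> ab; rewrite /f /= njM naM ztM baseM -ab mulKg tbE.
have baseK j a : base j (base j a) = base j a.
  by have [c ac] := base_in j a; rewrite [in RHS]ac baseM.
(* Two crossings return to the initial base point, with total factor z. *)
have ret b j a : j <= L -> [/\ nj j a <= L, base (nj j a) (na j a) = na j a,
    nj (nj j a) (na j a) = j, na (nj j a) (na j a) = base j a
    & exists d d', [/\ zt b j a = g d, zt (~~ b) (nj j a) (na j a) = g d', tau d = d & d' * d = z]].
  move=> jL; rewrite /nj /na; case: ifP => [ja|nja].
    have jL' : j < L by case/andP: ja.
    split; rewrite ?exit1 ?base1 ?entr1 //; first by rewrite /base ja.
    by exists 1, z; rewrite /zt ja exit1 // entr1 // !gmulf1 mulg1.
  case: ifP => [ja|nja'].
    case/andP: ja => j0 aC; have jL' : j.-1 < L by rewrite prednK.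
    have eqj : j.-1.+1 = j by rewrite prednK.
    split; rewrite ?exite ?eqj //; first by rewrite (leq_trans _ jL) ?leq_pred.
    - by rewrite /base exite.
    - rewrite /base nja; have /lcoset_eqP -> : a \in 1%g *: Cgp by rewrite lcoset1.
      by rewrite lcoset1 repr_group.
    by exists z, 1; rewrite /zt nja exite // /entr j0 aC gmulf1 mul1g tauz.
  have [c ac] := base_in j a.
  have xb : exit j (base j a) = false by rewrite -(exitM j _ c) -ac.
  have eb : entr j (base j a) = false by rewrite -(entrM j _ c) -ac.
  rewrite xb eb; split=> //; rewrite /zt xb eb nja nja' /=.
  by case: b; [exists z, 1 | exists 1, z]; rewrite !gmulf1 ?mul1g ?mulg1 ?tauz.
have ff t : f (f t) = transl (g z) t.
  case: t => [[b j] a]; have [c ac] := base_in j a.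
  have [njL nab njnj nana [d [d' [ztd ztd' td dd']]]] := ret b j (base j a) (ltnSE (ltn_ord j)).
  rewrite {1}ac fE // ztd -mulgA -gmulfM.
  rewrite fE ?inordK // njnj nana ztd' baseK inord_val negbK translE {2}ac -!mulgA -!gmulfM.
  by congr (_, _, _ * g _); rewrite gmulfM td mulgA dd' tau2.
have f_inj : injective f.
  by move=> t t' tt'; apply: (@perm_inj _ (transl (g z))); rewrite -!ff tt'.
exists (perm f_inj); split=> [|c|b j jL].
- by apply/permP => t; rewrite permM !(permE f_inj) ff.
- apply/permP => -[[b j] a]; rewrite !permM translE !(permE f_inj).
  have [d ad] := base_in j a.
  rewrite [in LHS]ad fE ?baseK // translE [in RHS]ad -(mulgA (base j a)) -(gmulfM d) fE ?baseK //.
  by rewrite -mulgA -!gmulfM.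
- rewrite (permE f_inj) /f /= inordK; last by rewrite ltnW.
  rewrite /nj /na /zt /base exite // mulVg.
  by have := tbE 1; rewrite !gmulf1 mulg1 => ->; rewrite mulg1.
Qed.

End Torsors.

(** * Normal forms in the amalgam and their detection *)

Variables (j : hom V G) (y s : G).
Hypothesis jy : forall v, y * j v = j (psi v) * y.
Hypothesis y3 : y * y * y = j (iota z).
Hypothesis s2 : s * s = j (iota z).
Hypothesis js : forall c, s * j (iota (tau c)) = j (iota c) * s.
(** [G_ind] and [G_univ] express that G is the amalgam: generation by the image of V, y and s, and
    the universal property for finite permutation groups. *)
Hypothesis G_ind : forall Q : G -> Prop, Q 1 ->
  (forall v g, Q g -> Q (j v * g)) -> (forall g, Q g -> Q (y * g)) ->
  (forall g, Q g -> Q (s * g)) -> forall g, Q g.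
Hypothesis G_univ : forall (T : finType) (h : hom V {perm T}) (y' s' : {perm T}),
  (forall v, y' * h v = h (psi v) * y') -> y' * y' * y' = h (iota z) ->
  s' * s' = h (iota z) -> (forall c, s' * h (iota (tau c)) = h (iota c) * s') ->
  exists eta : hom G {perm T}, [/\ forall v, eta (j v) = h v, eta y = y' & eta s = s'].

Definition edge_elt (u : V * 'I_3) : Prop := u.2 = ord0 /\ exists c, u.1 = iota c.

Definition vertex_elt (u : V * 'I_3) : G := j u.1 * y ^+ u.2.

Fixpoint syllables (u : V * 'I_3) (us : seq (V * 'I_3)) : G :=
  if us is u' :: us' then vertex_elt u * s * syllables u' us' else vertex_elt u.

(** Only a syllable followed by another is constrained. Applied to the list without its head [u_0],
    this concerns exactly the inner syllables. *)
Fixpoint reduced (us : seq (V * 'I_3)) : Prop :=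
  if us is u :: us' then (us' <> [::] -> ~ edge_elt u) /\ reduced us' else True.

Lemma syllables_mull v i w u us :
  w * vertex_elt u = vertex_elt (v, i) -> w * syllables u us = syllables (v, i) us.
Proof.
move=> wu; case: us => [|u' us]; first exact: wu.
by rewrite [in LHS]/syllables [in RHS]/syllables -/syllables -wu !mulgA.
Qed.

Lemma syllables_jmul v u us : j v * syllables u us = syllables (v * u.1, u.2) us.
Proof. by apply: syllables_mull; rewrite /vertex_elt /= gmulfM !mulgA. Qed.

(** Left multiplication by s may turn a first syllable c of C into an inner one; then s c s = z *
    [tau c] merges it with the next syllable. *)
Lemma normal_form (g : G) : exists u us, g = syllables u us /\ reduced us.
Proof.
elim/G_ind: g => [|v _ [u [us [-> red]]]|_ [u [us [-> red]]]|_ [u [us [-> red]]]].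
- by exists (1, ord0), [::]; rewrite /= /vertex_elt /= gmulf1 mul1g.
- by exists (v * u.1, u.2), us; rewrite syllables_jmul.
- case: u => v i; case: (ltnP i.+1 3) => i3.
    exists (psi v, Ordinal i3), us; split=> //; apply: syllables_mull.
    by rewrite /vertex_elt /= mulgA jy -mulgA expgS.
  exists (psi v * iota z, ord0), us; split=> //; apply: syllables_mull.
  rewrite /vertex_elt /= mulgA jy -mulgA -expgS gmulfM mulg1; congr (_ * _).
  have -> : i = 2 :> nat by apply/eqP; rewrite eqn_leq -ltnS ltn_ord.
  by rewrite !expgS expg0 mulg1 mulgA.
- case: us red => [|u' us] red.
    by exists (1, ord0), [:: u]; split=> //=; rewrite {2}/vertex_elt /= gmulf1 !mul1g.
  case: (pselect (edge_elt u)) => [[u0 [c uc]]|nu]; last first.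
    exists (1, ord0), [:: u, u' & us]; split=> //=.
    by rewrite {2}/vertex_elt /= gmulf1 !mul1g.
  exists (iota (z * tau c) * u'.1, u'.2), us; split; last by case: red.
  have sus : s * vertex_elt u * s = j (iota (z * tau c)).
    by rewrite /vertex_elt uc u0 mulg1 -mulgA -js mulgA s2 -!gmulfM.
  by rewrite -syllables_jmul -sus [syllables u _]/= !mulgA.
Qed.

(** One large [m] detects the finitely many elements of V involved. Membership of v in C is tested
    on [v / iota (rho v)], which is trivial exactly when v lies in C. *)
Lemma edge_separation (us : seq (V * 'I_3)) : exists (K : finGroupType) (h : hom V K) (y' : K),
  [/\ forall v, y' * h v = h (psi v) * y', y' * y' * y' = h (iota z),
      forall c, h (iota c) = 1 -> h (iota (tau c)) = 1
    & forall u, u \in us -> (~ edge_elt u -> forall c, h u.1 * y' ^+ u.2 <> h (iota c)) /\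
        (u <> (1, ord0) -> h u.1 * y' ^+ u.2 <> 1)].
Proof.
have /choice[M MP] : forall v : V, exists m0, v <> 1 -> forall m, m0 <= m ->
    exists f : hom V {perm 'I_m}, f v <> 1.
  move=> v; case: (pselect (v = 1)) => [->|/V_rf [m0 m0P]]; first by exists 0.
  by exists m0.
pose vs := [seq u.1 | u <- us] ++ [seq u.1 / iota (rho u.1) | u <- us].
pose m := (\max_(v <- vs) M v).+1.
have [K [h [y' [yh y3' htau hlab [h1 hC]]]]] := finite_quotient m.
have sep v : v \in vs -> (forall f : hom V {perm 'I_m}, f v = 1) -> v = 1.
  move=> vvs fv; apply: contrapT => v1; have [|f] := MP v v1 m.
    by rewrite /m ltnW // ltnS; apply: (@leq_bigmax_seq _ vs xpredT M).
  by rewrite fv.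
exists K, h, y'; split=> // -[v i] uus; split=> /=.
- move=> nu c; have [i0|i0] := posnP i; last by apply: hlab.
  rewrite i0 mulg1 => /hC fv; apply: nu; split; first exact: val_inj.
  exists (rho v); apply/divg1_eq/sep => [|f]; last by rewrite gmulfF -fv mulgV.
  by rewrite mem_cat; apply/orP; right; apply/mapP; exists (v, i).
- move=> u1; have [i0|i0] := posnP i; last first.
    by have := hlab i v 1; rewrite !gmulf1; apply.
  rewrite i0 mulg1 => /h1 fv; apply: u1; congr (_, _); last exact: val_inj.
  by apply: sep => //; rewrite mem_cat; apply/orP; left; apply/mapP; exists (v, i).
Qed.

Lemma reduced_nth us u0 k : reduced us -> k.+1 < size us -> ~ edge_elt (nth u0 us k).
Proof.
elim: us k => [//|u us IHus] [|k] /= [ru rus] kus; last exact: IHus.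
by apply: ru; case: us kus {rus IHus}.
Qed.

Theorem amalgam_rf : residually_finite G.
Proof.
move=> g g1; have [u [us [gE red]]] := normal_form g.
have [K [h [y' [yh y3' htau sep]]]] := edge_separation (u :: us).
pose val_K (w : V * 'I_3) := h w.1 * y' ^+ w.2.
pose L := size us; pose e k := val_K (nth u (u :: us) k).
have eC k c : 0 < k < L -> e k <> h (iota c).
  case: k => [//|k] /andP[_ kL]; apply: (sep _ _).1; first by rewrite mem_nth // /= ltnS ltnW.
  exact: (reduced_nth (u0 := u) red kL).
have [S [S2 Stau Se]] := torsor_perm htau eC.
pose R := transl K L.
have Ry3 : R y' * R y' * R y' = R (h (iota z)) by rewrite -!gmulfM y3'.
have Ryh v : R y' * R (h v) = R (h (psi v)) * R y' by rewrite -!gmulfM yh.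
have [eta [etaj etay etas]] := G_univ (h := comp_hom R h) Ryh Ry3 S2 Stau.
have etav w : eta (vertex_elt w) = R (val_K w).
  by rewrite gmulfM gmulfXn etaj etay /val_K gmulfM gmulfXn.
(* The k-th syllable translates the unit of the k-th copy to [e k], from where s leads to the unit
   of the next copy. *)
have walk w ws k b : k + size ws = L ->
    (forall i, i <= size ws -> e (k + i) = val_K (nth w (w :: ws) i)) ->
    exists b', eta (syllables w ws) (b, inord k, 1) = (b', inord L, e L).
  elim: ws w k b => [|w' ws IHws] w k b kL ew.
    exists b; rewrite -[syllables w _]/(vertex_elt w) etav translE mul1g.
    by rewrite -kL addn0 -(ew 0) ?addn0.
  have [||b' b'P] := IHws w' k.+1 (~~ b); first by rewrite addSnnS.
    move=> i iws; rewrite addSnnS ew //=.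
    by case: i iws => //= i iws; apply/congr1/set_nth_default.
  exists b'; rewrite -[syllables w _]/(vertex_elt w * s * syllables w' ws).
  rewrite gmulfM permM gmulfM permM etav translE mul1g etas.
  have := ew 0 isT; rewrite addn0 /= => <-; rewrite Se //.
  by rewrite -kL addnS ltnS leq_addr.
apply: (@residual_stabilizer _ _ eta g (false, ord0, 1)).
have [|i iL|b' b'P] := walk u us 0 false; rewrite ?add0n //.
rewrite gE; have <- : inord 0 = ord0 :> 'I_L.+1 by apply: val_inj; rewrite /= inordK.
(* Returning to the start forces L = 0, so g is a single syllable, which is detected in [K]
   itself. *)
rewrite b'P; apply/eqP => -[_ /(congr1 val)]; rewrite /= !inordK // => L0.
have us0 : us = [::] by apply: size0nil.
rewrite /e L0 /=; apply: (sep _ _).2; first by rewrite mem_head.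
by move=> u1; apply: g1; rewrite gE us0 u1 /= /vertex_elt /= gmulf1 mul1g.
Qed.

End Amalgam.

(** * The vertex and edge groups *)

Lemma conj_hom_subproof (G : groupType) (w : G) : {morph (fun x => x ^ w) : x y / x * y}.
Proof. by move=> x y; rewrite conjMg. Qed.

Definition conj_hom (G : groupType) (w : G) : hom G G := mk_hom (@conj_hom_subproof G w).

Definition id_hom (G : groupType) : hom G G := @mk_hom G G id (fun _ _ => erefl).

Lemma conjVP (G : groupType) (x y w : G) : x * w = w * y <-> x = y ^ w^-1.
Proof.
split=> [xw | ->]; first by rewrite conjgE invgK mulgA -xw mulgK.
by rewrite -conjgCV.
Qed.

Definition pos_word (X : Type) (xs : seq X) : word X := [seq (x, false) | x <- xs].

Arguments pos_word : simpl never.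

Lemma eval_pos_word (X : choiceType) (G : groupType) (f : X -> G) xs :
  eval_word f (pos_word xs) = \prod_(x <- xs) f x.
Proof. by rewrite /eval_word big_map. Qed.

Lemma prod_cons (X : Type) (G : groupType) (f : X -> G) x xs :
  \prod_(y <- x :: xs) f y = f x * \prod_(y <- xs) f y.
Proof. exact: big_cons. Qed.

(** A line with product P over a window continues by [e 0 ^ P] after it, and by [e n ^ P^-1] before
    it in [line_unshift]; the shifted window keeps the product P. *)
Lemma line_shift (H : groupType) n (e : nat -> H) (P := \prod_(k < n.+1) e k) :
  (\prod_(k < n) e k.+1) * e 0 ^ P = P.
Proof.
have PE : P = e 0 * \prod_(k < n) e k.+1 by rewrite /P big_ord_recl.
by apply: (mulgI (e 0)); rewrite mulgA -PE -conjgC.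
Qed.

Lemma line_unshift (H : groupType) n (e : nat -> H) (P := \prod_(k < n.+1) e k) :
  e n ^ P^-1 * (\prod_(k < n) e k) = P.
Proof.
have PE : P = (\prod_(k < n) e k) * e n by rewrite /P big_ord_recr.
by apply: (mulIg (e n)); rewrite -mulgA -PE -conjgCV.
Qed.

Section Vertex.
Variable N : nat.
Notation n := N.+4.

(** * Presentations of the edge and vertex groups by lines *)

Section Structures.
Variable H : groupType.
Implicit Types (z : H) (A B C : nat -> H).

Definition two_lines z A B := A 2 = B 0 /\ B 2 = A 0 ^ z^-1.

(** [C 3] is the conjugate by [z^-1] of the term preceding [B 0] in its line, so four consecutive
    terms of the third line come from the first two. *)
Definition three_lines z A B C :=
  [/\ C 0 = A 3, C 1%N = B 1%N, C 2 = A 1%N ^ z^-1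
    & C 3 = B N.+3 ^ (z * \prod_(k < n) B k)^-1].

End Structures.

(* [None] stands for z, and [letter m i k] for the k-th element of the i-th of
   m + 1 lines (numbered from 0). *)
Definition alphabet m := option ('I_m.+1 * 'I_n).
Definition letter m (i : nat) (k : nat) : alphabet m := Some (inord i, inord k).

Definition row m (i : nat) : seq (alphabet m) := mkseq (letter m i) n.
Definition row_last m (i : nat) : seq (alphabet m) := row m i ++ [:: letter m i N.+3].
Arguments row : simpl never.
Arguments row_last : simpl never.

(** An equation [x = y ^ w^-1] is encoded as [x * w = w * y], which involves positive words only. *)
Definition two_lines_rels m : seq (word (alphabet m) * word (alphabet m)) :=
  [:: (pos_word [:: letter m 0 2], pos_word [:: letter m 1 0]);
      (pos_word [:: letter m 1 2; None], pos_word [:: None; letter m 0 0])].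

Definition three_lines_rels : seq (word (alphabet 2) * word (alphabet 2)) :=
  two_lines_rels 2 ++
  [:: (pos_word [:: letter 2 2 0], pos_word [:: letter 2 0 3]);
      (pos_word [:: letter 2 2 1], pos_word [:: letter 2 1 1]);
      (pos_word [:: letter 2 2 2; None], pos_word [:: None; letter 2 0 1]);
      (pos_word [:: letter 2 2 3, None & row 2 1],
       pos_word (None :: row_last 2 1))].

Definition edge_group : groupType := presented (two_lines_rels 1).
Definition vertex_group : groupType := presented three_lines_rels.

Definition assign m (H : groupType) (z : H) (e : nat -> nat -> H) (x : alphabet m) : H :=
  if x is Some (i, k) then e i k else z.

Lemma assign_letter m (H : groupType) (z : H) e i k : i <= m -> k < n ->
  assign z e (letter m i k) = e i k.
Proof. by move=> im kn; rewrite /= !inordK. Qed.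

Lemma assign_row m (H : groupType) (z : H) e i : i <= m ->
  \prod_(x <- row m i) assign z e x = \prod_(k < n) e i k.
Proof.
move=> im; rewrite /row big_map -/(index_iota 0 n) big_mkord.
by apply: eq_bigr => k _; rewrite assign_letter.
Qed.

Lemma assign_row_last m (H : groupType) (z : H) e i : i <= m ->
  \prod_(x <- row_last m i) assign z e x = (\prod_(k < n) e i k) * e i N.+3.
Proof. by move=> im; rewrite /row_last big_cat big_seq1 assign_row ?assign_letter. Qed.

Lemma assign_gen m (R : seq (word (alphabet m) * word (alphabet m))) :
  gen R =1 assign (gen R None) (fun i k => gen R (letter m i k)).
Proof. by move=> [[i k]|] //=; rewrite /letter !inord_val. Qed.

Lemma two_lines_relsP m (H : groupType) (z : H) (e : nat -> nat -> H) : 0 < m ->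
  two_lines z (e 0) (e 1%N) <->
  forall u v, (u, v) \in two_lines_rels m ->
    eval_word (assign z e) u = eval_word (assign z e) v.
Proof.
move=> m0; split=> [[r1 r2] u v | rel].
  rewrite !inE => /orP[|] /eqP[-> ->]; rewrite !eval_pos_word !big_cons big_nil !assign_letter //.
    by rewrite !mulg1.
  by rewrite !mulg1; apply/conjVP.
have mem k uv : nth ([::], [::]) (two_lines_rels m) k = uv -> k < 2 ->
    uv \in two_lines_rels m by move=> <- k2; apply: mem_nth.
split.
- have := rel _ _ (mem 0 _ erefl isT).
  by rewrite !eval_pos_word !big_cons big_nil !assign_letter // !mulg1.
- have := rel _ _ (mem 1%N _ erefl isT).
  by rewrite !eval_pos_word !big_cons big_nil !assign_letter // !mulg1 => /conjVP.
Qed.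

Lemma three_lines_relsP (H : groupType) (z : H) (e : nat -> nat -> H) :
  two_lines z (e 0) (e 1%N) /\ three_lines z (e 0) (e 1%N) (e 2) <->
  forall u v, (u, v) \in three_lines_rels ->
    eval_word (assign z e) u = eval_word (assign z e) v.
Proof.
split=> [[r2 [r3 r4 r5 r6]] u v | rel].
  rewrite mem_cat => /orP[|]; first exact: (two_lines_relsP z e (isT : 0 < 2)).1.
  rewrite !inE => /or4P[] /eqP[-> ->]; rewrite !eval_pos_word.
  - by rewrite !big_cons big_nil !assign_letter // !mulg1.
  - by rewrite !big_cons big_nil !assign_letter // !mulg1.
  - by rewrite !big_cons big_nil !assign_letter // !mulg1; apply/conjVP.
  - rewrite (prod_cons _ (letter 2 2 3)) !(prod_cons _ None) assign_row_last // !assign_row //.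
    by rewrite !assign_letter // [RHS]mulgA; apply/conjVP.
split; first by apply/(two_lines_relsP z e (isT : 0 < 2)) => u v uv; apply: rel; rewrite mem_cat uv.
have mem k (uv : word (alphabet 2) * word (alphabet 2)) :
    nth ([::], [::]) (drop 2 three_lines_rels) k = uv -> k < 4 -> uv \in three_lines_rels.
  by move=> <- k4; rewrite -[X in _ \in X](cat_take_drop 2) mem_cat mem_nth ?orbT.
split.
- have := rel _ _ (mem 0 _ erefl isT).
  by rewrite !eval_pos_word !big_cons big_nil !assign_letter // !mulg1.
- have := rel _ _ (mem 1%N _ erefl isT).
  by rewrite !eval_pos_word !big_cons big_nil !assign_letter // !mulg1.
- have := rel _ _ (mem 2 _ erefl isT).
  by rewrite !eval_pos_word !big_cons big_nil !assign_letter // !mulg1 => /conjVP.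
- have := rel _ _ (mem 3 _ erefl isT).
  rewrite !eval_pos_word (prod_cons _ (letter 2 2 3)) !(prod_cons _ None) assign_row_last //.
  by rewrite !assign_row // !assign_letter // [RHS]mulgA => /conjVP.
Qed.

Lemma lines_hom m (R : seq (word (alphabet m) * word (alphabet m))) (H : groupType)
    (z : H) (e : nat -> nat -> H) :
  (forall u v, (u, v) \in R -> eval_word (assign z e) u = eval_word (assign z e) v) ->
  exists h : hom (presented R) H, h (gen R None) = z /\
    forall i k, i <= m -> k < n -> h (gen R (letter m i k)) = e i k.
Proof.
move=> /pres_hom[h hE]; exists h; split=> [|i k im kn]; first exact: hE.
by rewrite hE assign_letter.
Qed.

Lemma lines_hom_ext m (R : seq (word (alphabet m) * word (alphabet m))) (H : groupType)
    (f g : hom (presented R) H) :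
  f (gen R None) = g (gen R None) ->
  (forall i k, i <= m -> k < n -> f (gen R (letter m i k)) = g (gen R (letter m i k))) ->
  f =1 g.
Proof.
move=> fg0 fg; apply: pres_hom_ext => -[[i k]|] //.
by have := fg i k (ltnSE (ltn_ord i)) (ltn_ord k); rewrite /letter !inord_val.
Qed.

Definition edge_z : edge_group := gen _ None.
Definition edge_A k : edge_group := gen _ (letter 1 0 k).
Definition edge_B k : edge_group := gen _ (letter 1 1 k).
Definition vert_z : vertex_group := gen _ None.
Definition vert_A k : vertex_group := gen _ (letter 2 0 k).
Definition vert_B k : vertex_group := gen _ (letter 2 1 k).
Definition vert_C k : vertex_group := gen _ (letter 2 2 k).

Lemma edge_lines : two_lines edge_z edge_A edge_B.
Proof.
apply/(two_lines_relsP edge_z (fun i k => gen _ (letter 1 i k)) (isT : 0 < 1)) => u v uv.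
by have <- := funext (@assign_gen _ (two_lines_rels 1)); exact: gen_rel.
Qed.

Lemma vert_lines :
  two_lines vert_z vert_A vert_B /\ three_lines vert_z vert_A vert_B vert_C.
Proof.
apply/(three_lines_relsP vert_z (fun i k => gen _ (letter 2 i k))) => u v uv.
by have <- := funext (@assign_gen _ three_lines_rels); exact: gen_rel.
Qed.

Lemma edge_hom (H : groupType) (z : H) A B : two_lines z A B ->
  exists h : hom edge_group H, [/\ h edge_z = z, forall k, k < n -> h (edge_A k) = A k
    & forall k, k < n -> h (edge_B k) = B k].
Proof.
move=> zAB; pose e i := if i is 0 then A else B.
have [h [hz he]] := lines_hom ((two_lines_relsP z e (isT : 0 < 1)).1 zAB).
by exists h; split=> // k; [exact: (he 0) | exact: (he 1%N)].
Qed.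

Lemma vert_hom (H : groupType) (z : H) A B C : two_lines z A B -> three_lines z A B C ->
  exists h : hom vertex_group H, [/\ h vert_z = z, forall k, k < n -> h (vert_A k) = A k,
    forall k, k < n -> h (vert_B k) = B k & forall k, k < n -> h (vert_C k) = C k].
Proof.
move=> zAB zABC; pose e i := if i is 0 then A else if i is 1%N then B else C.
have [h [hz he]] := lines_hom ((three_lines_relsP z e).1 (conj zAB zABC)).
by exists h; split=> // k; [exact: (he 0) | exact: (he 1%N) | exact: (he 2)].
Qed.

Lemma edge_hom_ext (H : groupType) (f g : hom edge_group H) :
  f edge_z = g edge_z -> (forall k, k < n -> f (edge_A k) = g (edge_A k)) ->
  (forall k, k < n -> f (edge_B k) = g (edge_B k)) -> f =1 g.
Proof.
move=> fgz fgA fgB; apply: (lines_hom_ext fgz) => -[|[|i]] k // _; by [exact: fgA | exact: fgB].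
Qed.

Lemma vert_hom_ext (H : groupType) (f g : hom vertex_group H) :
  f vert_z = g vert_z -> (forall k, k < n -> f (vert_A k) = g (vert_A k)) ->
  (forall k, k < n -> f (vert_B k) = g (vert_B k)) ->
  (forall k, k < n -> f (vert_C k) = g (vert_C k)) -> f =1 g.
Proof.
move=> fgz fgA fgB fgC; apply: (lines_hom_ext fgz) => -[|[|[|i]]] k // _;
  by [exact: fgA | exact: fgB | exact: fgC].
Qed.

(** Solving the relations for [B 0], [B 2] and [C 0], ..., [C 3] defines [p] from V to the free
    group on the whole alphabet. Evaluation [q] satisfies q (p v) = v, so [p] is injective and
    representations pull back along it. *)
Lemma vertex_group_rf (v : vertex_group) : v <> 1 -> exists m0, forall m, m0 <= m ->
  exists f : hom vertex_group {perm 'I_m}, f v <> 1.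
Proof.
move=> v1; pose F := presented (X := alphabet 2) [::].
pose z : F := gen _ None; pose x i k : F := gen _ (letter 2 i k).
pose A := x 0.
pose B k := if k is 0 then A 2 else if k is 2 then A 0 ^ z^-1 else x 1%N k.
pose C k := match k with
  | 0 => A 3 | 1 => B 1%N | 2 => A 1%N ^ z^-1
  | 3 => B N.+3 ^ (z * \prod_(i < n) B i)^-1 | _ => x 2 k end.
have [||p [pz pA pB pC]] := @vert_hom F z A B C; [by [] | by [] |].
have [//|q qE] := @pres_hom (alphabet 2) [::] vertex_group (gen three_lines_rels).
have [[r1 r2] [r3 r4 r5 r6]] := vert_lines.
have qA k : q (A k) = vert_A k by exact: qE.
have qz : q z = vert_z by exact: qE.
have qB k : q (B k) = vert_B k.
  case: k => [|[|[|k]]]; rewrite /B ?gmulfJ ?gmulfV ?qA ?qz //; exact: qE.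
have qp : (fun u => q (p u)) =1 id.
  apply: (@vert_hom_ext _ (comp_hom q p) (id_hom _)) => /= [|k kn|k kn|k kn].
  - by rewrite pz.
  - by rewrite pA.
  - by rewrite pB.
  rewrite pC //; case: k kn => [|[|[|[|k]]]] kn;
    rewrite /C ?gmulfJ ?gmulfV ?gmulfM ?gmulf_prod ?qA ?qz ?qB //.
    by rewrite r6; congr (_ ^ (_ * _)^-1); apply: eq_bigr => i _; rewrite qB.
  exact: qE.
have pv : p v <> 1 by move=> pv1; apply: v1; rewrite -(qp v) pv1 gmulf1.
have [m0 m0P] := free_group_rf pv; exists m0 => m /m0P[f fp].
by exists (comp_hom f p).
Qed.

(** * Retraction, twist and rotation *)

Definition inclusion (iota : hom edge_group vertex_group) :=
  [/\ iota edge_z = vert_z, forall k, k < n -> iota (edge_A k) = vert_A k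
    & forall k, k < n -> iota (edge_B k) = vert_B k].

Lemma edge_retract : exists (iota : hom edge_group vertex_group)
  (rho : hom vertex_group edge_group), inclusion iota /\ cancel iota rho.
Proof.
have [iota [iz iA iB]] := edge_hom vert_lines.1.
(* The first four values are forced by [three_lines]; the N remaining terms of the third line are
   free and are sent to 1. *)
pose C k := match k with
  | 0 => edge_A 3 | 1 => edge_B 1%N | 2 => edge_A 1%N ^ edge_z^-1
  | 3 => edge_B N.+3 ^ (edge_z * \prod_(i < n) edge_B i)^-1 | _ => 1 end.
have [|rho [rz rA rB _]] := @vert_hom _ edge_z edge_A edge_B C edge_lines; first by [].
exists iota, rho; split; first by [].
apply: (@edge_hom_ext _ (comp_hom rho iota) (id_hom _)) => /= [|k kn|k kn].
- by rewrite iz.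
- by rewrite iA // rA.
- by rewrite iB // rB.
Qed.

(** This models c -> s^-1 c s, where s^2 = z and s^-1 conjugates A_k to B_k. *)
Definition twist (tau : hom edge_group edge_group) :=
  [/\ tau edge_z = edge_z, forall k, k < n -> tau (edge_A k) = edge_B k ^ edge_z,
      forall k, k < n -> tau (edge_B k) = edge_A k & forall c, tau (tau c) = c ^ edge_z].

Lemma edge_twist : exists tau, twist tau.
Proof.
have [r1 r2] := edge_lines.
have [|tau [tz tA tB]] := @edge_hom _ edge_z (fun k => edge_B k ^ edge_z) edge_A.
  by split; rewrite ?r1 ?r2 ?conjgK ?conjgKV.
exists tau; split=> //.
apply: (@edge_hom_ext _ (comp_hom tau tau) (conj_hom edge_z)) => /= [|k kn|k kn].
- by rewrite !tz conjgE mulKg.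
- by rewrite tA // gmulfJ tB // tz.
- by rewrite tB // tA.
Qed.

(** This models v -> y v y^-1. With lines extended to all indices, the rule is A_k -> B_(k-1) -> C_k
    -> z A_k z^-1; the conjugates by products are the terms just outside the window. *)
Definition rotation (psi : hom vertex_group vertex_group) :=
  [/\ psi vert_z = vert_z,
      psi (vert_A 0) = vert_B N.+3 ^ (\prod_(k < n) vert_B k)^-1,
      forall k, k.+1 < n -> psi (vert_A k.+1) = vert_B k,
      (forall k, k.+1 < n -> psi (vert_B k) = vert_C k.+1) /\
        psi (vert_B N.+3) = vert_C 0 ^ (\prod_(k < n) vert_C k)
    & [/\ psi (vert_A 0 ^ (\prod_(k < n) vert_A k)) = vert_B N.+3,
        forall k, k < n -> psi (vert_C k) = vert_A k ^ vert_z^-1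
      & forall v, psi (psi (psi v)) = v ^ vert_z^-1]].

Lemma vert_rotation : exists psi, rotation psi.
Proof.
have [[r1 r2] [r3 r4 r5 r6]] := vert_lines.
set PB := \prod_(k < n) vert_B k; set PC := \prod_(k < n) vert_C k.
pose A k := if k is k'.+1 then vert_B k' else vert_B N.+3 ^ PB^-1.
pose B k := if k == N.+3 then vert_C 0 ^ PC else vert_C k.+1.
pose C k := vert_A k ^ vert_z^-1.
have PA' : \prod_(k < n) A k = PB by rewrite big_ord_recl; exact: (line_unshift N.+3 vert_B).
have PB' : \prod_(k < n) B k = PC.
  rewrite big_ord_recr /= {2}/B eqxx -[RHS](line_shift N.+3 vert_C); congr (_ * _).
  by apply: eq_bigr => k _; rewrite /B /= ltn_eqF.
(* The rotation permutes the six relations, up to conjugation by z, in two cycles of length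
   three. *)
have [||psi [pz pA pB pC]] := @vert_hom _ vert_z A B C.
- split; first by rewrite /A /B /= r4.
  by rewrite /A /B /= -conjgM -invMg r6.
- split; rewrite /A /B /C /=.
  + by rewrite r2.
  + by rewrite r5.
  + by rewrite r1.
  + by rewrite eqxx PB' -conjgM -/PC invMg mulgA mulgV mul1g r3.
have pPB : psi PB = PC.
  by rewrite gmulf_prod -PB'; apply: eq_bigr => k _; rewrite pB.
have pPC : psi PC = (\prod_(k < n) vert_A k) ^ vert_z^-1.
  by rewrite gmulf_prod conjg_prod; apply: eq_bigr => k _; rewrite pC.
have pPA : psi (\prod_(k < n) vert_A k) = PB.
  by rewrite gmulf_prod -PA'; apply: eq_bigr => k _; rewrite pA.
have pB' k : k.+1 < n -> psi (vert_B k) = vert_C k.+1.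
  by move=> kn; rewrite pB 1?ltnW // /B ltn_eqF.
have pBn : psi (vert_B N.+3) = vert_C 0 ^ PC by rewrite pB // /B eqxx.
have pA0 : psi (psi (vert_A 0)) = vert_C 0.
  by rewrite pA // /A gmulfJ gmulfV pBn pPB conjgK.
have pA3 k : k < n -> psi (psi (psi (vert_A k))) = vert_A k ^ vert_z^-1.
  case: k => [|k] kn; first by rewrite pA0 pC.
  by rewrite pA // pB' // pC.
exists psi; split=> //.
- by rewrite pA.
- by move=> k kn; rewrite pA.
split; [by rewrite gmulfJ pPA pA // /A conjgKV | exact: pC |].
apply: (@vert_hom_ext _ (comp_hom psi (comp_hom psi psi)) (conj_hom vert_z^-1)) => /=.
- by rewrite !pz conjgE mulgV mulg1 invgK.
- exact: pA3.
- move=> k kn; case: (ltnP k.+1 n) => kn'.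
    by rewrite pB' // pC // gmulfJ gmulfV pz pA.
  have -> : k = N.+3 by lia.
  rewrite pBn gmulfJ pC // pPC -conjJg !gmulfJ gmulfV pz pPA pA // /A.
  by rewrite conjgKV.
- move=> k kn; rewrite pC // !gmulfJ !gmulfV !pz; congr (_ ^ _).
  case: k kn => [|k] kn; first by rewrite pA0.
  by rewrite pA // pB'.
Qed.

End Vertex.

(** * The triangle Artin group *)

Lemma eval_alt_word_even (X : choiceType) (G : groupType) (f : X -> G) s t m :
  eval_word f (alt_word s t (2 * m)) = (f s * f t) ^+ m.
Proof.
have -> : eval_word f (alt_word s t (2 * m)) =
    \prod_(0 <= i < (2 * m)%N) f (if odd i then t else s).
  by rewrite /eval_word big_map /index_iota subn0.
elim: m => [|m IHm]; first by rewrite muln0 big_geq.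
rewrite mulnSr addn2 !big_nat_recr //= IHm expgSr mul2n odd_double /=.
by rewrite mulgA.
Qed.

Lemma artin_relsP (G : groupType) (f : artin_gen -> G) m :
  (forall u v, (u, v) \in [:: (alt_word ga gb 2, alt_word gb ga 2);
       (alt_word gb gc 3, alt_word gc gb 3);
       (alt_word gc ga (2 * m), alt_word ga gc (2 * m))] ->
     eval_word f u = eval_word f v) <->
  [/\ f ga * f gb = f gb * f ga, f gb * f gc * f gb = f gc * f gb * f gc
    & (f gc * f ga) ^+ m = (f ga * f gc) ^+ m].
Proof.
have e2 s t : eval_word f (alt_word s t 2) = f s * f t.
  by rewrite -[2]/(2 * 1)%N eval_alt_word_even expg1.
have e3 s t : eval_word f (alt_word s t 3) = f s * f t * f s.
  by rewrite /eval_word !big_cons big_nil mulg1 mulgA.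
split=> [rel | [r1 r2 r3] u v].
  by split; [rewrite -!e2 | rewrite -!e3 | rewrite -!eval_alt_word_even];
    apply: rel; rewrite !inE eqxx ?orbT.
by rewrite !inE => /or3P[] /eqP[-> ->]; rewrite ?eval_alt_word_even ?e2 ?e3.
Qed.

(** Collecting every c on the right leaves a product of successive conjugates of a, which turns
    [rca] into a statement about a line. *)
Lemma conj_expg (G : groupType) (a c : G) m :
  (c * a) ^+ m = (\prod_(k < m) a ^ (c ^+ k.+1)^-1) * c ^+ m.
Proof.
elim: m => [|m IHm]; first by rewrite big_ord0 mulg1.
rewrite expgSr IHm big_ord_recr /= -[LHS]mulgA -[RHS]mulgA; congr (_ * _).
by rewrite -conjgCV expgSr -mulgA.
Qed.

Section Triangle.
Variable N : nat.
Notation n := N.+4.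
Notation V := (vertex_group N).
Notation C := (edge_group N).

(** * Three lines inside the triangle Artin group *)

Section Relations.
Variable G : groupType.
Variables a b c : G.
Hypothesis rab : a * b = b * a.
Hypothesis rbc : b * c * b = c * b * c.
Hypothesis rca : (c * a) ^+ n = (a * c) ^+ n.

Definition tri_y := c * b.
Definition tri_s := b * c * b.
Definition tri_z := tri_y * tri_y * tri_y.
(* That is, c^(k-1) a c^(1-k): the shift by one makes [tri_A 0] a conjugate of a
   by c^-1, as the indexing of [three_lines] requires. *)
Definition tri_A k := a ^ (c ^+ k * c^-1)^-1.
Definition tri_B k := tri_A k ^ tri_s^-1.
Definition tri_C k := tri_A k ^ (tri_y * tri_y)^-1.

Lemma tri_sE : tri_s = tri_y * c. Proof. exact: rbc. Qed.
Lemma tri_ss : tri_s * tri_s = tri_z.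
Proof. by rewrite /tri_z {1}/tri_s rbc /tri_s /tri_y !mulgA. Qed.
Lemma tri_A1 : tri_A 1%N = a. Proof. by rewrite /tri_A expg1 mulgV invg1 conjg1. Qed.

Lemma tri_AS k : tri_A k ^ c^-1 = tri_A k.+1.
Proof. by rewrite /tri_A -conjgM -invMg expgS !mulgA. Qed.

Lemma tri_A0S k : tri_A 0 ^ (c ^+ k.+1)^-1 = tri_A k.+1.
Proof. by rewrite /tri_A expg0 mul1g -conjgM -invMg. Qed.

Lemma tri_BE k : tri_B k = tri_A k.+1 ^ tri_y^-1.
Proof. by rewrite /tri_B tri_sE invMg conjgM tri_AS. Qed.

(** By [conj_expg], (a c)^n is A_1 ... A_n times c^n. By [rca] it commutes with c, hence so does A_1
    ... A_n, and conjugation by c shifts that window to A_0, ..., A_(n-1). *)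
Lemma tri_A_line : \prod_(k < n) tri_A k.+1 = \prod_(k < n) tri_A k.
Proof.
pose P := \prod_(k < n) tri_A k.+1.
have cA0 : c * tri_A 0 = a * c by rewrite /tri_A expg0 mul1g invgK conjgE mulVKg.
have acP : (a * c) ^+ n = P * c ^+ n.
  rewrite -cA0 conj_expg; congr (_ * _); apply: eq_bigr => k _.
  exact: tri_A0S.
have Pc : P ^ c = P.
  have : (a * c) ^+ n ^ c = (a * c) ^+ n.
    rewrite -[in LHS]rca conjXg; congr (_ ^+ _).
    by rewrite conjgE -!mulgA mulKg.
  by rewrite acP conjMg [c ^+ n ^ c]conjgE -expgSr expgS mulKg => /mulIg.
rewrite -/P -Pc /P conjg_prod; apply: eq_bigr => k _.
by rewrite -tri_AS conjgKV.
Qed.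

Lemma tri_AnE : tri_A n = tri_A 0 ^ (\prod_(k < n) tri_A k).
Proof.
apply: (mulgI (\prod_(k < n) tri_A k)).
have AS : \prod_(k < n.+1) tri_A k = (\prod_(k < n) tri_A k) * tri_A n.
  by rewrite big_ord_recr.
rewrite -conjgC -AS.
by rewrite big_ord_recl -[in RHS]tri_A_line.
Qed.

Lemma tri_A0E : tri_A 0 ^ tri_y^-1 = tri_B N.+3 ^ (\prod_(k < n) tri_B k)^-1.
Proof.
have -> : \prod_(k < n) tri_B k = (\prod_(k < n) tri_A k) ^ tri_y^-1.
  by rewrite -tri_A_line conjg_prod; apply: eq_bigr => k _; rewrite tri_BE.
by rewrite tri_BE -conjVg -conjJg tri_AnE conjgK.
Qed.

Lemma tri_CnE : tri_A n ^ (tri_y * tri_y)^-1 = tri_C 0 ^ (\prod_(k < n) tri_C k).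
Proof. by rewrite tri_AnE conjJg conjg_prod. Qed.

Lemma triangle_two_lines : two_lines tri_z tri_A tri_B.
Proof.
(* Here [rab] enters: as a commutes with b, conjugating a by [y^-1] amounts to conjugating it by
   [c^-1]. *)
have r1 : tri_A 2 = tri_B 0.
  by rewrite tri_BE -tri_AS tri_A1 /tri_y invMg conjgM [a ^ b^-1]conjgE invgK mulgA -rab mulgK.
split=> //; rewrite {1}/tri_B r1 /tri_B -conjgM -invMg tri_ss //.
Qed.

(** These are the relations of [triangle_two_lines] conjugated by powers of y, with y^3 = z. *)
Lemma triangle_three_lines : three_lines N tri_z tri_A tri_B tri_C.
Proof.
have [r1 r2] := triangle_two_lines.
have r3 : tri_A 3 = tri_C 0.
  apply: (@conjg_inj _ tri_y^-1); rewrite -tri_BE r2 /tri_C -conjgM -invMg.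
  by congr (_ ^ _^-1); rewrite /tri_z !mulgA.
split; rewrite /tri_C.
- by rewrite r3.
- by rewrite tri_A1 tri_BE r1 tri_BE tri_A1 -conjgM -invMg.
- by rewrite r1 tri_BE -conjgM -invMg; congr (_ ^ _^-1); rewrite /tri_z !mulgA.
- rewrite r3 /tri_C [(tri_z * _)^-1]invMg [in RHS]conjgM -tri_A0E -!conjgM -!invMg.
  by congr (_ ^ _^-1); rewrite /tri_z !mulgA.
Qed.

End Relations.

(** Conversely, compatible images of V, y and s yield a triple satisfying the Artin relations; this
    gives the Artin group the universal property of the amalgam. *)
Lemma amalgam_universal (H : groupType) (h : hom V H) (y s : H)
    (iota : hom C V) (psi : hom V V) (tau : hom C C) :
  inclusion iota -> rotation psi -> twist tau ->
  (forall v, y * h v = h (psi v) * y) -> y * y * y = h (iota (edge_z N)) ->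
  s * s = h (iota (edge_z N)) -> (forall c, s * h (iota (tau c)) = h (iota c) * s) ->
  let a := h (vert_A N 1) in let b := s * y^-1 in let c := y^-1 * s in
  [/\ a * b = b * a, b * c * b = c * b * c & (c * a) ^+ n = (a * c) ^+ n] /\
  [/\ c * b = y, b * c * b = s & forall k, k < n -> h (vert_A N k) = tri_A a c k].
Proof.
move=> [iz iA iB] [pz pA0 pA _ [pAn _ _]] [tz tA tB _] yh y3 s2 hs a b c.
have hy v : h (psi v) = h v ^ y^-1 by apply/conjVP; rewrite yh.
have y3s2 : y * y * y = s * s by rewrite y3 s2.
have hsA k : k < n -> h (vert_A N k) = h (vert_B N k) ^ s.
  move=> kn; apply: (mulgI s); rewrite -conjgC -(iA _ kn) -(iB _ kn) -hs tB //.
(* Conjugation by s^-1 takes A_k to B_k, and conjugation by y takes B_k to A_(k+1); so c^-1 = s^-1 y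
   shifts the line. *)
have cA k : k.+1 < n -> h (vert_A N k) ^ c^-1 = h (vert_A N k.+1).
  move=> kn; rewrite /c invMg invgK conjgM hsA 1?ltnW // conjgK -pA // hy.
  by rewrite conjgKV.
have cA0 : h (vert_A N 0) = a ^ c by rewrite /a -cA // conjgKV.
have hA k : k < n -> h (vert_A N k) = tri_A a c k.
  elim: k => [|k IHk] kn; first by rewrite /tri_A expg0 mul1g invgK cA0.
  by rewrite -tri_AS -IHk 1?ltnW // cA.
have cb : c * b = y.
  by rewrite /c /b !mulgA -[y^-1 * s * s]mulgA -y3s2 !mulgA mulVg mul1g mulgK.
have bcb : b * c * b = s.
  rewrite -mulgA cb /b mulgVK //.
have cbc : c * b * c = s by rewrite cb /c mulVKg.
pose P := \prod_(k < n) h (vert_A N k).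
(* The last factor leaves the window; [pAn] identifies its image with the next term of the line. *)
have Pc : P ^ c^-1 = P.
  rewrite -[RHS](line_shift N.+3 (fun k => h (vert_A N k))).
  rewrite [in LHS]/P [in LHS]big_ord_recr [in LHS]/= conjMg conjg_prod; congr (_ * _).
    by apply: eq_bigr => k _; rewrite cA // ltnS.
  rewrite /c invMg invgK conjgM hsA // conjgK -pAn hy conjgKV gmulfJ.
  by rewrite gmulf_prod.
have acn : (a * c) ^+ n = P * c ^+ n.
  have -> : a * c = c * h (vert_A N 0) by rewrite cA0 -conjgC.
  rewrite conj_expg -[in RHS]Pc conjg_prod; congr (_ * _); apply: eq_bigr => k _.
  by rewrite !hA // tri_A0S tri_AS.
split; split=> //; last 2 first.
- by rewrite bcb cbc.
- have -> : c * a = (a * c) ^ c^-1 by rewrite conjgE invgK mulgK.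
  by rewrite -conjXg acn conjMg Pc; congr (_ * _); rewrite conjXg conjgE mulgV mulg1 invgK.
(* Since a^s = B_1^(y^3), a^b is B_1^(y^2), and conjugating twice by y leads from B_1 through A_2 =
   B_0 to A_1 = a. *)
suff ab : a ^ b = a by rewrite (conjgC a b) ab.
have [[r1 _] [_ _ _ _]] := vert_lines N.
have as_ : a ^ s = h (vert_B N 1) ^ (y * y * y).
  rewrite y3 -gmulfJ /a -(iA 1%N) // -(iB 1%N) // -gmulfJ -tA //.
  by apply: (mulgI s); rewrite -conjgC hs.
have By : h (vert_B N 1) ^ (y * y) = a.
  by rewrite -(pA 1%N) // hy r1 -(pA 0) // hy conjgM !conjgKV.
by rewrite /b conjgM as_ conjgM conjgK By.
Qed.

End Triangle.

Lemma conj_cube (G : groupType) (y : G) : (y * y * y) ^ y^-1 = y * y * y.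
Proof. by rewrite conjgE invgK !mulgA mulgK. Qed.

Lemma inv_cube (G : groupType) (y : G) : y^-1 = y * y * (y * y * y)^-1.
Proof. by rewrite !invMg !mulgA mulgK mulgV mul1g. Qed.

Lemma inv_square (G : groupType) (s : G) : s^-1 = s * (s * s)^-1.
Proof. by rewrite invMg mulgA mulgV mul1g. Qed.

Lemma conj_square (G : groupType) (s : G) : (s * s) ^ s = s * s.
Proof. by rewrite conjgE !mulgA mulVg mul1g. Qed.

(** [amalgam_rf] applies once [jpsi] and [jtau] have checked on generators that [psi] and [tau]
    become conjugation by [y^-1] and by [s]. *)
Lemma triangle_artin_rf N : residually_finite (triangle_artin 2 3 (2 * N.+4)).
Proof.
set R := [:: (alt_word ga gb 2, alt_word gb ga 2); (alt_word gb gc 3, alt_word gc gb 3);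
  (alt_word gc ga (2 * N.+4), alt_word ga gc (2 * N.+4))].
pose a : triangle_artin 2 3 (2 * N.+4) := gen R ga.
pose b : triangle_artin 2 3 (2 * N.+4) := gen R gb.
pose c : triangle_artin 2 3 (2 * N.+4) := gen R gc.
have [rab rbc rca] := (artin_relsP (gen R) N.+4).1 (@gen_rel _ R).
have [iota [rho [iotaP rhoK]]] := edge_retract N.
have [psi psiP] := vert_rotation N; have [tau tauP] := edge_twist N.
have [j [jz jA jB jC]] := vert_hom (triangle_two_lines rab rbc)
  (triangle_three_lines rab rbc rca).
have [iz iA iB] := iotaP.
have [pz pA0 pA [pB pBn] [_ pC psi3]] := psiP; have [tz tA tB tau2] := tauP.
pose y := tri_y b c; pose s := tri_s b c.
have ss : s * s = tri_z b c by exact: tri_ss.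
have jiz : j (iota (edge_z N)) = tri_z b c by rewrite iz jz.
have jpsi v : j (psi v) = j v ^ y^-1.
  apply: (@vert_hom_ext N _ (comp_hom j psi) (comp_hom (conj_hom y^-1) j)) => /= [|k kn|k kn|k kn].
  - by rewrite pz jz; apply/esym/conj_cube.
  - case: k kn => [|k] kn; last by rewrite pA // jA // jB 1?ltnW // tri_BE.
    rewrite pA0 gmulfJ gmulfV gmulf_prod jA // jB // (tri_A0E rbc rca).
    by congr (_ ^ _^-1); apply: eq_bigr => k _; rewrite jB.
  - rewrite jB // tri_BE // -conjgM -invMg; case: (ltnP k.+1 N.+4) => kn'.
      by rewrite pB // jC.
    have -> : k = N.+3 by lia.
    rewrite pBn gmulfJ gmulf_prod jC // (tri_CnE b rca).
    by congr (_ ^ _); apply: eq_bigr => i _; rewrite jC.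
  - rewrite pC // gmulfJ gmulfV jz jC // jA // /tri_C -[RHS]conjgM -[in RHS]invMg.
    by congr (_ ^ _^-1); exact: (esym (mulgA y y y)).
have jtau e : j (iota (tau e)) = j (iota e) ^ s.
  apply: (@edge_hom_ext N _ (comp_hom j (comp_hom iota tau))
    (comp_hom (conj_hom s) (comp_hom j iota))) => /= [|k kn|k kn].
  - by rewrite tz jiz -ss conj_square.
  - rewrite tA // !gmulfJ iB // jB // jiz iA // jA // -ss /tri_B -conjgM.
    by rewrite mulKg.
  - by rewrite tB // iA // jA // iB // jB // conjgKV.
(* The induction principle [G_ind] offers only the left factors y, s and images of V, so inverses
   are expressed through these. *)
have yV : y^-1 = y * y * j (vert_z N)^-1.
  by rewrite gmulfV jz; apply: inv_cube.
have sV : s^-1 = s * j (vert_z N)^-1.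
  by rewrite gmulfV jz -ss; apply: inv_square.
have bE : b = s * y^-1 by rewrite /s /y /tri_s /tri_y invMg !mulgA !mulgK.
have cE : c = y^-1 * s by rewrite /s tri_sE // mulKg.
apply: (@amalgam_rf _ _ _ (alphabet N 2) (gen (three_lines_rels N)) _
  (@vertex_group_rf N) iota rho psi tau (edge_z N) rhoK _ _ _ tz j y s).
- by move=> P f g; apply: pres_hom_ext.
- by move=> v; rewrite psi3 iz -conjgCV.
- by rewrite iz.
- by move=> e; rewrite tau2 -conjgC.
- by move=> v; rewrite jpsi -conjgCV.
- by rewrite jiz.
- by rewrite jiz.
- by move=> e; rewrite jtau -conjgC.
- move=> Q Q1 Qj Qy Qs g.
  have QyV h : Q h -> Q (y^-1 * h) by move=> Qh; rewrite yV -[_ * h]mulgA -[y * y * _]mulgA; auto.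
  have QsV h : Q h -> Q (s^-1 * h) by move=> Qh; rewrite sV -[_ * h]mulgA; auto.
  have aE : a = j (vert_A N 1) by rewrite jA // tri_A1.
  rewrite -[g]class_of_repr class_of_eval /eval_word.
  elim: generic_quotient.repr => [|[x e] w IHw]; first by rewrite big_nil.
  rewrite big_cons; case: x; case: e => /=.
  + by rewrite -/a aE -gmulfV; auto.
  + by rewrite -/a aE; auto.
  + by rewrite -/b bE invMg invgK -mulgA; auto.
  + by rewrite -/b bE -mulgA; auto.
  + by rewrite -/c cE invMg invgK -mulgA; auto.
  + by rewrite -/c cE -mulgA; auto.
- move=> T h y' s' yh y3 s2 hs.
  (* The triple obtained here defines [eta]. It agrees with [h] on the first line by [eA], and on
     the other two by conjugating with s and y. *)
  have [[r1 r2 r3] [ey es eA]] := amalgam_universal iotaP psiP tauP yh y3 s2 hs.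
  set a' := h _ in r1 r3 eA; set b' := s' * _ in r1 r2 ey es.
  set c' := y'^-1 * _ in r2 r3 ey es eA.
  pose f x := match x with ga => a' | gb => b' | gc => c' end.
  have [eta etaE] := pres_hom ((artin_relsP f N.+4).2 (And3 r1 r2 r3)).
  have eta_y : eta y = y' by rewrite -ey /y /tri_y gmulfM etaE etaE.
  have eta_s : eta s = s' by rewrite -es /s /tri_s !gmulfM !etaE.
  exists eta; split=> //.
  have etaA k : k < N.+4 -> eta (j (vert_A N k)) = h (vert_A N k).
    move=> kn; rewrite jA // eA // /tri_A !(gmulfJ, gmulfV, gmulfM, gmulfXn).
    by rewrite !etaE.
  have hpsi v : h (psi v) = h v ^ y'^-1 by apply/conjVP; rewrite yh.
  have htau e : h (iota (tau e)) = h (iota e) ^ s'.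
    by apply: (mulgI s'); rewrite -conjgC hs.
  apply: (@vert_hom_ext N _ (comp_hom eta j) h) => //= [|k kn|k kn].
  + by rewrite jz /tri_z -/y gmulfM [eta (y * y)]gmulfM eta_y y3 iz.
  + rewrite jB // /tri_B gmulfJ gmulfV -/s eta_s -jA // etaA //.
    by rewrite -(iA _ kn) -(tB _ kn) htau iB // conjgK.
  + rewrite jC // -[tri_C _ _ _ _]/(tri_A a c k ^ (y * y)^-1) gmulfJ gmulfV -jA // etaA //.
    rewrite gmulfM eta_y invMg conjgM; apply: (@conjg_inj _ y'^-1).
    by rewrite -!hpsi psi3 pC.
Qed.

Local Close Scope group_scope.

Theorem theorem1p1 (n : nat) (hn : 3 < n) :
  residually_finite (triangle_artin 2 3 (2 * n)).
Proof.
by case: n hn => [|[|[|[|N]]]] // _; apply: triangle_artin_rf.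
Qed.
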